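(* Assume that: (a) the model $\{r(\cdot;\theta):\theta\in\Theta\}$ contains the constant function $1$; (b) for every $\theta\in\Theta$, the constant function $1$ belongs to $\mathcal{L}[\nabla\log r(x;\theta)]$; (c) $f(1)=f'(1)=0$. Let $f(r)=\bar f_{\mathrm d}(r)+r\bar f_{\mathrm n}(r)$ be a decomposition of $f$ and let $\bar\eta(x;\theta)\in\mathbb{R}^d$ be a vector-valued function such that, for all $\theta\in\Theta$ (and all densities $p_{\mathrm n},p_{\mathrm d}$ with $p_{\mathrm n}(x)/p_{\mathrm d}(x)=r(x;\theta)$), $$f(r(x;\theta))-\big(r(x;\theta)+\rho^{-1}\big)\big(\bar f_{\mathrm n}(r(x;\theta))+\bar c^{\,T}U_{\bar\eta}^{-1}\bar\eta(x;\theta)\big)\in\mathcal{L}[\nabla\log r(x;\theta)],$$ where $\bar c=\mathrm{E}_{\mathrm n}[\{f'(r(x;\theta))-\bar f_{\mathrm n}(r(x;\theta))\}\nabla\log r(x;\theta)]$ and $U_{\bar\eta}=\mathrm{E}_{\mathrm n}[\bar\eta(x;\theta)\nabla\log r(x;\theta)^T]$. Then the estimator $\bar D_f$ of the $f$-divergence built from $\bar\eta$ and the decomposition $f(r)=\bar f_{\mathrm d}(r)+r\bar f_{\mathrm n}(r)$ uniformly attains the minimum asymptotic variance: for every $\theta^*\in\Theta$ and all densities with $p_{\mathrm n}/p_{\mathrm d}=r(\cdot;\theta^* )$, the asymptotic variance of $\bar D_f$ is less than or equal to the asymptotic variance of the estimator $\widehat D_f$ built from any vector-valued function $\eta$ and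 any decomposition $f(r)=f_{\mathrm d}(r)+r f_{\mathrm n}(r)$.
   Context: Let $p_{\mathrm n},p_{\mathrm d}$ be probability densities on $\mathcal{X}$ and $f$ a strictly convex differentiable function on $(0,\infty)$ with $f(1)=0$. The $f$-divergence is $D_f=D_f(p_{\mathrm d},p_{\mathrm n})=\int p_{\mathrm d}(x)f(p_{\mathrm n}(x)/p_{\mathrm d}(x))\,dx$. $\mathrm{E}_{\mathrm n},\mathrm{V}_{\mathrm n}$ (resp. $\mathrm{E}_{\mathrm d},\mathrm{V}_{\mathrm d}$) denote expectation and variance under $p_{\mathrm n}$ (resp. $p_{\mathrm d}$). A density-ratio model is a family of positive functions $r(x;\theta)$, $\theta\in\Theta\subset\mathbb{R}^d$, differentiable in $\theta$; the model is correctly specified, i.e. $p_{\mathrm n}(x)/p_{\mathrm d}(x)=r(x;\theta^* )$ for some $\theta^*\in\Theta$. $\nabla$ is the gradient in $\theta$ (column vector). For $\eta=(\eta_1,\dots,\eta_d)^T$, $\mathcal{L}[\eta(x;\theta)]=\{\sum_{k=1}^d a_k\eta_k(x;\theta): a_1,\dots,a_d\in\mathbb{R}\}$ is the linear space of functions of $x$ spanned by the components of $\eta(\cdot;\theta)$; in particular $\mathcal{L}[\nabla\log r(x;\theta)]$ is the span of $\partial_1\log r(x;\theta),\dots,\partial_d\log r(x;\theta)$. Data: independent i.i.d. samples $x^{(\mathrm n)}_1,\dots,x^{(\mathrm n)}_{m_{\mathrm n}}\sim p_{\mathrm n}$ and $x^{(\mathrm d)}_1,\dots,x^{(\mathrm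 d)}_{m_{\mathrm d}}\sim p_{\mathrm d}$. Put $m=m_{\mathrm n}m_{\mathrm d}/(m_{\mathrm n}+m_{\mathrm d})$; $\rho\in(0,\infty)$ is the limit of $m_{\mathrm n}/m_{\mathrm d}$. For $\eta(x;\theta)\in\mathbb{R}^d$, the moment matching estimator $\widehat\theta$ solves $Q_\eta(\widehat\theta)=0$, where $$Q_\eta(\theta)=\frac1{m_{\mathrm d}}\sum_{i=1}^{m_{\mathrm d}}r(x^{(\mathrm d)}_i;\theta)\eta(x^{(\mathrm d)}_i;\theta)-\frac1{m_{\mathrm n}}\sum_{j=1}^{m_{\mathrm n}}\eta(x^{(\mathrm n)}_j;\theta).$$ A decomposition of $f$ is a pair of functions with $f(r)=f_{\mathrm d}(r)+rf_{\mathrm n}(r)$. The associated estimator built from $\eta$ and $(f_{\mathrm d},f_{\mathrm n})$ is $$\widehat D_f=\frac1{m_{\mathrm d}}\sum_{i=1}^{m_{\mathrm d}}f_{\mathrm d}(r(x^{(\mathrm d)}_i;\widehat\theta))+\frac1{m_{\mathrm n}}\sum_{j=1}^{m_{\mathrm n}}f_{\mathrm n}(r(x^{(\mathrm n)}_j;\widehat\theta)).$$ Set $U_\eta=\mathrm{E}_{\mathrm n}[\eta\,\nabla\log r^T]$ (a $d\times d$ matrix, assumed non-degenerate for every $\eta$ considered) and $c=\mathrm{E}_{\mathrm n}[\{f'(r)-f_{\mathrm n}(r)\}\nabla\log r]$. Under standing regularity conditions, $\sqrt m(\widehat D_f-D_f)=\mathbb{P}f-\sqrt m\,c^TU_\eta^{-1}Q_\eta(\theta^*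 )+o_p(1)$ with everything evaluated at $\theta^*$, where $$\mathbb{P}f=\sqrt{\tfrac{\rho}{\rho+1}}\tfrac1{\sqrt{m_{\mathrm d}}}\sum_{i}\big[f_{\mathrm d}(r(x_i^{(\mathrm d)}))-\mathrm{E}_{\mathrm d}f_{\mathrm d}(r)\big]+\sqrt{\tfrac{1}{\rho+1}}\tfrac1{\sqrt{m_{\mathrm n}}}\sum_{j}\big[f_{\mathrm n}(r(x_j^{(\mathrm n)}))-\mathrm{E}_{\mathrm n}f_{\mathrm n}(r)\big].$$ The asymptotic variance of $\widehat D_f$ is the (limiting) variance of this leading term, namely $$\frac{\rho}{1+\rho}\mathrm{V}_{\mathrm d}\big[f_{\mathrm d}(r)-c^TU_\eta^{-1}r\eta\big]+\frac1{1+\rho}\mathrm{V}_{\mathrm n}\big[f_{\mathrm n}(r)+c^TU_\eta^{-1}\eta\big],$$ evaluated at $\theta=\theta^*$; all functions involved are assumed to have the required finite second moments. *)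

(* Defs.v *)
From HB Require Import structures.
From mathcomp Require Import all_boot all_order all_algebra.
From mathcomp Require Import all_classical all_reals all_analysis.

Set Implicit Arguments.
Unset Strict Implicit.
Unset Printing Implicit Defensive.

Import Order.TTheory GRing.Theory Num.Theory.
Import numFieldNormedType.Exports.
Local Open Scope classical_set_scope.
Local Open Scope ring_scope.

Definition strictly_convex_on (R : realType) (D : set R) (f : R -> R) : Prop :=
  forall s t a : R, D s -> D t -> s != t -> 0 < a -> a < 1 ->
    f (a * s + (1 - a) * t) < a * f s + (1 - a) * f t.

(* f may take arbitrary values outside ]0, +oo[, where it is never used. *)
Definition divergence_generator (R : realType) (f : R -> R) : Prop :=
  [/\ strictly_convex_on [set t | 0 < t] f,
      forall t : R, 0 < t -> derivable f t 1 & f 1 = 0].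

Definition decomposition (R : realType) (f fd fn : R -> R) : Prop :=
  forall t : R, 0 < t -> f t = fd t + t * fn t.

Definition is_density d (X : measurableType d) (R : realType)
    (mu : {measure set X -> \bar R}) (p : X -> R) (P : probability X R) : Prop :=
  [/\ measurable_fun [set: X] p, forall x, 0 <= p x &
      forall A, measurable A -> P A = (\int[mu]_(x in A) (p x)%:E)%E].

(* Positivity of pd is stated because the quotient is total (t / 0 = 0); as
   r is positive, it forces pn to be positive as well. *)
Definition has_density_ratio d (X : measurableType d) (R : realType)
    (mu : {measure set X -> \bar R}) (q : X -> R) (Pn Pd : probability X R) :
    Prop :=
  exists pn pd : X -> R,
    [/\ is_density mu pn Pn, is_density mu pd Pd, forall x, 0 < pd x &
        forall x, pn x / pd x = q x].

Section model.
Context d (X : measurableType d) (R : realType) (n : nat).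
Implicit Types (r : X -> 'cV[R]_n -> R) (eta : X -> 'cV[R]_n -> 'cV[R]_n).
Implicit Types (f fd fn : R -> R) (theta : 'cV[R]_n) (Pn Pd : probability X R).

(* r is defined on the whole parameter space R^n, but constrained only on
   Theta, which need not be open. *)
Definition density_ratio_model (Theta : set 'cV[R]_n) r : Prop :=
  forall theta, Theta theta ->
    forall x, 0 < r x theta /\ differentiable (r x) theta.

Definition grad (g : 'cV[R]_n -> R) theta : 'cV[R]_n :=
  \col_k 'D_(delta_mx k 0) g theta.

Definition score r : X -> 'cV[R]_n -> 'cV[R]_n :=
  fun x theta => grad (fun t => ln (r x t)) theta.

Definition lin_span (v : X -> 'cV[R]_n) : set (X -> R) :=
  [set g | exists a : 'cV[R]_n, forall x, g x = \sum_k a k 0 * v x k 0].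

Definition Umat r eta Pn theta : 'M[R]_n :=
  \matrix_(j, k) fine ('E_Pn[fun x => eta x theta j 0 * score r x theta k 0]).

Definition cvec r f fn Pn theta : 'cV[R]_n :=
  \col_k fine ('E_Pn[fun x =>
    (derive1 f (r x theta) - fn (r x theta)) * score r x theta k 0]).

(* The function c^T U^-1 eta of x; note that c depends on fn. *)
Definition correction r f fn eta Pn theta (x : X) : R :=
  ((cvec r f fn Pn theta)^T *m invmx (Umat r eta Pn theta)
     *m eta x theta) 0 0.

(* Membership in Lfun includes measurability; together with the Lfun
   conditions on the products, which make the entries of c and U finite, these
   are the moment conditions under which the asymptotic variance is defined. *)
Definition regular_at r f eta fd fn Pn Pd theta : Prop :=
  [/\ ((fun x => fd (r x theta)) \in Lfun Pd 2%:E) /\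
      ((fun x => fn (r x theta)) \in Lfun Pn 2%:E),
      forall j, ((fun x => r x theta * eta x theta j 0) \in Lfun Pd 2%:E) /\
                ((fun x => eta x theta j 0) \in Lfun Pn 2%:E),
      forall k, (fun x => (derive1 f (r x theta) - fn (r x theta))
                            * score r x theta k 0) \in Lfun Pn 1%:E,
      forall j k, (fun x => eta x theta j 0 * score r x theta k 0)
                    \in Lfun Pn 1%:E &
      Umat r eta Pn theta \in unitmx].

(* Limiting variance of the leading term of sqrt m (Dhat - D_f), where
     Dhat = 1/md sum_i fd (r (xd_i; thetahat)) + 1/mn sum_j fn (r (xn_j; thetahat)),
   thetahat solves the moment matching equation
     1/md sum_i r (xd_i) eta (xd_i) = 1/mn sum_j eta (xn_j),
   m = mn md / (mn + md) and mn / md --> rho. *)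
Definition asymptotic_variance r f (rho : R) eta fd fn Pn Pd theta : \bar R :=
  ((rho / (1 + rho))%:E * 'V_Pd[(fun x => fd (r x theta)
      - r x theta * correction r f fn eta Pn theta x)%R]
   + (1 / (1 + rho))%:E * 'V_Pn[(fun x => fn (r x theta)
      + correction r f fn eta Pn theta x)%R])%E.

End model.

(* Main.v *)
(* Write w for the density ratio, s for the score and v = fn(w) + c^T U^-1 eta.
   Since fd(w) - w c^T U^-1 eta = f(w) - w v, the asymptotic variance is a
   function of v alone:
     rho/(1+rho) V_d[f(w) - w v] + 1/(1+rho) V_n[v].
   The definition of c and U gives E_n[(f'(w) - v) s_k] = 0 for every k, whatever
   eta and the decomposition, so the difference delta between two such v is
   orthogonal in L^2(Pn) to the span of the score, which contains 1. Hence
   replacing vbar by vbar + delta adds nonnegative variances and a cross term,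
     2/(1+rho) E_n[(vbar - rho (f(w) - w vbar)) delta]
       = - 2 rho/(1+rho) E_n[(f(w) - (w + 1/rho) vbar) delta],
   which vanishes because the optimality condition puts the first factor in
   the span of the score. *)

Require Import Defs.
From HB Require Import structures.
From mathcomp Require Import all_boot all_order all_algebra.
From mathcomp Require Import all_classical all_reals all_analysis.
From mathcomp Require Import measurable_realfun ring.

Set Implicit Arguments.
Unset Strict Implicit.
Unset Printing Implicit Defensive.

Import Order.TTheory GRing.Theory Num.Theory.
Import numFieldNormedType.Exports.
Local Open Scope classical_set_scope.
Local Open Scope ring_scope.

(** * Densities and change of measure *)

Section density.
Context d (X : measurableType d) (R : realType).
Local Open Scope ereal_scope.

(** [p] and the Radon-Nikodym derivative of [P] have the same integral over every measurable set,
    hence agree [mu]-almost everywhere; the change of variables for the derivative then transfers to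
    [p]. *)
Lemma density_ge0_integral (mu : {sigma_finite_measure set X -> \bar R})
    (p : X -> R) (P : probability X R) (g : X -> \bar R) :
  is_density mu p P -> measurable_fun [set: X] g -> (forall x, 0 <= g x) ->
  \int[P]_x g x = \int[mu]_x (g x * (p x)%:E).
Proof.
move=> [mp p0 Pp] mg g0.
have Pmu : P `<< mu.
  apply/null_content_dominatesP => A mA muA0; rewrite Pp//.
  by apply: null_set_integral => //; apply/measurable_EFinP/measurable_funTS.
have iP := Radon_Nikodym_SigmaFinite.f_integrable Pmu.
rewrite -(Radon_Nikodym_SigmaFinite.change_of_variables Pmu)//.
apply: ae_eq_integral => //.
- by apply: emeasurable_funM => //; exact: measurable_int iP.
- by apply: emeasurable_funM => //; exact/measurable_EFinP.
- apply: ae_eqe_mul2l; apply: integral_ae_eq => //; first exact/measurable_EFinP.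
  by move=> E _ mE; rewrite -Pp// -(Radon_Nikodym_SigmaFinite.f_integral Pmu).
Qed.

(** Since [p] is nonnegative, multiplication by [p] commutes with taking positive and negative
    parts, which reduces the claim to nonnegative integrands. *)
Lemma density_expectation (mu : probability X R)
    (p g : X -> R) (P : probability X R) :
  is_density mu p P -> measurable_fun [set: X] g ->
  'E_P[g] = 'E_mu[g \* p].
Proof.
move=> dP mg; have [mp p0 _] := dP.
rewrite unlock integralE [in RHS]integralE.
have mG : measurable_fun [set: X] (EFin \o g) by exact/measurable_EFinP.
rewrite !(density_ge0_integral dP)//; last 2 first.
- exact: measurable_funeneg.
- exact: measurable_funepos.
congr (_ - _); apply: eq_integral => x _.
- by rewrite !funeposE/= EFinM maxe_pMl ?lee_fin// mul0e.
- rewrite !funenegE/= -mulNr EFinM.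
  by rewrite maxe_pMl ?lee_fin// mul0e.
Qed.

(** Chain rule for densities. It eliminates [mu]: afterwards only [Pd] and the density [q] of [Pn]
    relative to it are needed. *)
Lemma density_ratio_is_density (mu : {sigma_finite_measure set X -> \bar R})
    (q : X -> R) (Pn Pd : probability X R) :
  has_density_ratio mu q Pn Pd -> is_density Pd q Pn.
Proof.
move=> [pn [pd [[mpn pn0 Pnp] dPd pd0 pq]]].
have [mpd _ _] := dPd.
have qE : q = fun x => (pn x / pd x)%R by apply/funext => x; rewrite pq.
have q0 x : (0 <= q x)%R by rewrite qE divr_ge0// ltW.
have mq : measurable_fun [set: X] q.
  rewrite qE; apply: measurable_funM => //.
  have -> : (fun x => (pd x)^-1)%R = (fun x => pd x `^ (-1))%R.
    by apply/funext => x; rewrite powR_inv1// ltW.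
  exact: (measurableT_comp (measurable_powR (-1)%R) mpd).
split => // A mA.
rewrite Pnp// [LHS]integral_mkcond [RHS]integral_mkcond.
rewrite (density_ge0_integral dPd); last 2 first.
- apply/(measurable_restrictT _ _).1 => //.
  exact/measurable_funTS/measurable_EFinP.
- by move=> x; rewrite patchE; case: ifPn => // _; rewrite lee_fin.
apply: eq_integral => x _; rewrite !patchE; case: ifPn => _; last by rewrite mul0e.
by rewrite -EFinM qE divfK// gt_eqF.
Qed.

End density.

(** * Effect of a perturbation on the weighted sum of variances *)

Section variance.
Context d (X : measurableType d) (R : realType).
Implicit Types P Q : probability X R.
Local Open Scope ereal_scope.

Lemma Lfun2D P (u v : X -> R) :
  u \in Lfun P 2%:E -> v \in Lfun P 2%:E -> (u \+ v)%R \in Lfun P 2%:E.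
Proof. by move=> ? ?; rewrite rpredD ?lee1n. Qed.

Lemma Lfun2N P (u : X -> R) :
  u \in Lfun P 2%:E -> (\- u)%R \in Lfun P 2%:E.
Proof. by move=> ?; rewrite rpredN ?lee1n. Qed.

(** Expand the variance of the sum and drop the variance of [v]; as [v] is centred, the covariance
    is the expectation of the product. *)
Lemma variance_addl_ge P (u v : X -> R) :
  u \in Lfun P 2%:E -> v \in Lfun P 2%:E -> 'E_P[v] = 0 ->
  'V_P[u] + 2%:E * 'E_P[(u \* v)%R] <= 'V_P[(u \+ v)%R].
Proof.
move=> u2 v2 v0; have Pfin : P setT \is a fin_num by rewrite fin_num_measure.
rewrite varianceD// covarianceE ?Lfun2_mul_Lfun1 ?(Lfun_subset12 Pfin)//.
rewrite v0 mule0 sube0 leeD2r//.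
by rewrite leeDl// variance_ge0.
Qed.

(** Each variance is bounded below by its unperturbed value plus a cross term. Change of measure
    writes both cross terms under [Q], where the last hypothesis makes their weighted sum vanish. *)
Lemma variance_sum_le P Q (w u v dl : X -> R) (rho : R) :
  (0 < rho)%R -> is_density P w Q ->
  u \in Lfun P 2%:E -> (w \* dl)%R \in Lfun P 2%:E ->
  v \in Lfun Q 2%:E -> dl \in Lfun Q 2%:E ->
  'E_Q[dl] = 0 -> 'E_Q[(v \* dl)%R] = rho%:E * 'E_Q[(u \* dl)%R] ->
  (rho / (1 + rho))%:E * 'V_P[u] + (1 / (1 + rho))%:E * 'V_Q[v] <=
  (rho / (1 + rho))%:E * 'V_P[(u \- w \* dl)%R]
    + (1 / (1 + rho))%:E * 'V_Q[(v \+ dl)%R].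
Proof.
move=> rho0 dQ u2 wd2 v2 dl2 dl0 ortho.
have mL (P' : probability X R) (h : X -> R) : h \in Lfun P' 2%:E -> measurable_fun [set: X] h.
  by rewrite inE => /andP[/[!inE]].
have wdN2 : (\- (w \* dl))%R \in Lfun P 2%:E by exact: Lfun2N.
have wd1 : (w \* dl)%R \in Lfun P 1.
  by rewrite Lfun_subset12// fin_num_measure.
have E0 : 'E_P[(w \* dl)%R] = 0.
  rewrite -dl0 (density_expectation dQ)//; last exact: mL dl2.
  by congr expectation; apply/funext => x /=; rewrite mulrC.
have EN0 : 'E_P[(\- (w \* dl))%R] = 0.
  have -> : (\- (w \* dl) = -1 \o* (w \* dl))%R by apply/funext => x /=; rewrite mulrN1.
  by rewrite expectationZl// E0 mule0.
have uwd1 : (u \* (w \* dl))%R \in Lfun P 1 by exact: Lfun2_mul_Lfun1.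
have Euwd : 'E_Q[(u \* dl)%R] = 'E_P[(u \* (w \* dl))%R].
  rewrite (density_expectation dQ); last first.
    by apply: measurable_funM; [exact: mL u2|exact: mL dl2].
  by congr expectation; apply/funext => x /=; rewrite mulrCA mulrC.
have EuwN : 'E_P[(u \* (\- (w \* dl)))%R] = - 'E_Q[(u \* dl)%R].
  have -> : (u \* (\- (w \* dl)) = -1 \o* (u \* (w \* dl)))%R.
    by apply/funext => x /=; rewrite mulrN1 mulrN.
  by rewrite expectationZl// Euwd EFinN mulNe mul1e.
have h1 := variance_addl_ge u2 wdN2 EN0; rewrite EuwN in h1.
have h2 := variance_addl_ge v2 dl2 dl0; rewrite ortho in h2.
(* Finiteness of all five quantities allows the inequality to be settled in [R]. *)
have Vn2 := variance_fin_num v2; have Vd2 := variance_fin_num u2.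
have e_fin : 'E_Q[(u \* dl)%R] \is a fin_num by rewrite Euwd expectation_fin_num.
have V1 : 'V_P[(u \+ (\- (w \* dl)))%R] \is a fin_num.
  by apply: variance_fin_num; exact: Lfun2D.
have V2 : 'V_Q[(v \+ dl)%R] \is a fin_num.
  by apply: variance_fin_num; exact: Lfun2D.
change (u \- w \* dl)%R with (u \+ (\- (w \* dl)))%R.
move: h1 h2; rewrite -(fineK Vn2) -(fineK Vd2) -(fineK e_fin) -(fineK V1) -(fineK V2).
rewrite -!(EFinN, EFinM, EFinD) !lee_fin.
move: (fine _) (fine _) (fine _) (fine _) (fine _) => a b c e g h1 h2.
(* The gap is a nonnegative combination of the slacks in [h1] and [h2]; the weight [rho] on the
   first cancels [e]. *)
rewrite -subr_ge0 [leRHS](_ : _ =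
  (rho * (c - (g + 2 * - e)) + (a - (b + 2 * (rho * e)))) / (1 + rho))%R.
  apply: divr_ge0; last by rewrite addr_ge0// ltW.
  by rewrite addr_ge0 ?subr_ge0// mulr_ge0 ?subr_ge0// ltW.
by field; rewrite gt_eqF// addr_gt0.
Qed.

End variance.

(** * Integrability and expectation of finite linear combinations *)

Section linear_combination.
Context d (X : measurableType d) (R : realType) (P : probability X R) (n : nat).
Implicit Types (a : 'I_n -> R) (h : 'I_n -> X -> R).

Lemma Lfun_lincomb (p : R) a h : 1 <= p ->
  (forall j, h j \in Lfun P p%:E) ->
  (fun x => \sum_j a j * h j x) \in Lfun P p%:E.
Proof.
move=> p1 hp; elim: (index_enum _) => [|j s IHs].
  rewrite [X in X \in _](_ : _ = cst 0) ?Lfun_cst//.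
  by apply/funext => x; rewrite big_nil.
rewrite [X in X \in _](_ : _ =
    (a j \o* h j) \+ (fun x => \sum_(i <- s) a i * h i x)); last first.
  by apply/funext => x; rewrite big_cons/= mulrC.
by rewrite rpredD ?lee_fin// Lfun_scale.
Qed.

Lemma expectation_lincomb a h :
  (forall j, h j \in Lfun P 1) ->
  ('E_P[fun x => (\sum_j a j * h j x)%R] = \sum_j (a j)%:E * 'E_P[h j])%E.
Proof.
move=> h1; rewrite unlock.
under eq_integral do rewrite -sumEFin.
rewrite integral_sum//; last first.
  move=> j; under eq_fun do rewrite EFinM.
  by apply: integrableZl => //; exact/Lfun1_integrable.
apply: eq_bigr => j _; under eq_integral do rewrite EFinM.
by rewrite integralZl//; exact/Lfun1_integrable.
Qed.

End linear_combination.

(** * The moment matching correction and its pairing with the score *)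

Section moment_matching.
Context d (X : measurableType d) (R : realType) (n : nat).
Context (r : X -> 'cV[R]_n -> R) (f : R -> R) (eta : X -> 'cV[R]_n -> 'cV[R]_n).
Context (fd fn : R -> R) (Pn Pd : probability X R) (theta : 'cV[R]_n).
Context (reg : regular_at r f eta fd fn Pn Pd theta).

Let a : 'rV[R]_n :=
  (cvec r f fn Pn theta)^T *m invmx (Umat r eta Pn theta).

Let correctionE x :
  correction r f fn eta Pn theta x = \sum_j a 0 j * eta x theta j 0.
Proof. by rewrite /correction mxE. Qed.

Lemma correction_Lfun2 :
  correction r f fn eta Pn theta \in Lfun Pn 2%:E.
Proof.
have [_ eta2 _ _ _] := reg.
rewrite (_ : correction _ _ _ _ _ _ =
    fun x => \sum_j a 0 j * eta x theta j 0); last exact/funext.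
by apply: Lfun_lincomb; [rewrite ler1n|move=> j; exact: (eta2 j).2].
Qed.

Lemma ratio_correction_Lfun2 :
  (fun x => r x theta * correction r f fn eta Pn theta x) \in Lfun Pd 2%:E.
Proof.
have [_ eta2 _ _ _] := reg.
rewrite (_ : (fun _ => _) =
    fun x => \sum_j a 0 j * (r x theta * eta x theta j 0)); last first.
  apply/funext => x; rewrite correctionE mulr_sumr.
  by apply: eq_bigr => j _; rewrite mulrCA.
by apply: Lfun_lincomb; [rewrite ler1n|move=> j; exact: (eta2 j).1].
Qed.

Let cscore k x := correction r f fn eta Pn theta x * score r x theta k 0.

Let cscoreE k : cscore k =
  fun x => \sum_j a 0 j * (eta x theta j 0 * score r x theta k 0).
Proof.
apply/funext => x; rewrite /cscore correctionE mulr_suml.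
by apply: eq_bigr => j _; rewrite mulrA.
Qed.

Let cscore_Lfun1 k : cscore k \in Lfun Pn 1.
Proof.
have [_ _ _ es1 _] := reg.
by rewrite cscoreE; apply: (@Lfun_lincomb _ _ _ _ _ 1) => // j; exact: es1.
Qed.

(** By linearity the left side is an entry of [a *m U], and [U] cancels its inverse in [a]. *)
Let cscore_expectation k : ('E_Pn[cscore k] = (cvec r f fn Pn theta k 0)%:E)%E.
Proof.
have [_ _ _ es1 Uunit] := reg.
rewrite cscoreE expectation_lincomb => [|j]; last exact: es1.
have aU : a *m Umat r eta Pn theta = (cvec r f fn Pn theta)^T.
  by rewrite /a mulmxKV.
have <- : (a *m Umat r eta Pn theta) 0 k = cvec r f fn Pn theta k 0.
  by rewrite aU mxE.
rewrite mxE -sumEFin.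
apply: eq_bigr => j _; rewrite [Umat _ _ _ _ _ _]mxE EFinM fineK//.
by rewrite expectation_fin_num//; exact: es1.
Qed.

Let residual_scoreE k :
  (fun x => (derive1 f (r x theta) -
     (fn (r x theta) + correction r f fn eta Pn theta x))
     * score r x theta k 0) =
  (fun x => (derive1 f (r x theta) - fn (r x theta)) * score r x theta k 0)
    \- cscore k.
Proof. by apply/funext => x; rewrite /= opprD addrA mulrBl. Qed.

Lemma residual_score_Lfun1 k :
  (fun x => (derive1 f (r x theta) -
     (fn (r x theta) + correction r f fn eta Pn theta x))
     * score r x theta k 0) \in Lfun Pn 1.
Proof.
have [_ _ fs1 _ _] := reg.
by rewrite residual_scoreE rpredB.
Qed.

(* [c^T U^-1] is exactly the coefficient vector that makes the residual
   uncorrelated with the score. *)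
Lemma residual_score_expectation k :
  ('E_Pn[(fun x => (derive1 f (r x theta) -
     (fn (r x theta) + correction r f fn eta Pn theta x))
     * score r x theta k 0)%R] = 0)%E.
Proof.
have [_ _ fs1 _ _] := reg.
rewrite residual_scoreE expectationB//.
rewrite cscore_expectation mxE fineK ?subee//.
all: by rewrite expectation_fin_num//; exact: fs1.
Qed.

End moment_matching.

(** * Comparison of the two estimators *)

Theorem theorem1 (R : realType) (dX : measure_display) (X : measurableType dX)
  (mu : {sigma_finite_measure set X -> \bar R})
  (n : nat) (Theta : set 'cV[R]_n) (r : X -> 'cV[R]_n -> R)
  (f : R -> R) (rho : R)
  (etabar : X -> 'cV[R]_n -> 'cV[R]_n) (fdbar fnbar : R -> R)
  (r_model : density_ratio_model Theta r)
  (f_gen : divergence_generator f)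
  (rho_gt0 : 0 < rho)
  (model_has_one : exists2 theta, Theta theta & forall x, r x theta = 1)
  (one_in_span : forall theta, Theta theta ->
     lin_span (fun x => score r x theta) (fun=> 1))
  (f1_eq0 : f 1 = 0) (df1_eq0 : derive1 f 1 = 0)
  (bar_decomposition : decomposition f fdbar fnbar)
  (bar_condition : forall theta, Theta theta ->
     forall Pn Pd : probability X R,
     has_density_ratio mu (fun x => r x theta) Pn Pd ->
     regular_at r f etabar fdbar fnbar Pn Pd theta ->
     lin_span (fun x => score r x theta)
       (fun x => f (r x theta) - (r x theta + rho^-1) *
          (fnbar (r x theta) + correction r f fnbar etabar Pn theta x))) :
  forall theta, Theta theta ->
  forall Pn Pd : probability X R,
  has_density_ratio mu (fun x => r x theta) Pn Pd ->
  regular_at r f etabar fdbar fnbar Pn Pd theta ->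
  forall (eta : X -> 'cV[R]_n -> 'cV[R]_n) (fd fn : R -> R),
  decomposition f fd fn ->
  regular_at r f eta fd fn Pn Pd theta ->
  (asymptotic_variance r f rho etabar fdbar fnbar Pn Pd theta
     <= asymptotic_variance r f rho eta fd fn Pn Pd theta)%E.
Proof.
move=> theta th Pn Pd ratio regb eta fd fn dec reg.
have dPn := density_ratio_is_density ratio.
have w0 x : 0 < r x theta by have [] := r_model theta th x.
set corrb := correction r f fnbar etabar Pn theta.
set corr := correction r f fn eta Pn theta.
pose vb x := fnbar (r x theta) + corrb x.
pose v x := fn (r x theta) + corr x.
pose dl := v \- vb.
pose u x := f (r x theta) - r x theta * vb x.
pose w x := r x theta.
have uE : (fun x => fdbar (r x theta) - r x theta * corrb x) = u.
  by apply/funext => x; rewrite /u /vb (bar_decomposition _ (w0 x)); ring.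
have uwE : (fun x => fd (r x theta) - r x theta * corr x) = u \- w \* dl.
  apply/funext => x; rewrite /u /w /dl /v /=.
  rewrite [fd _](_ : _ = f (r x theta) - r x theta * fn (r x theta)).
    ring.
  by rewrite (dec _ (w0 x)); ring.
have vE : (fun x => fn (r x theta) + corr x) = vb \+ dl.
  by apply/funext => x; rewrite /dl /= [RHS]addrC subrK.
rewrite /asymptotic_variance -/corr -/corrb uE uwE vE.
have vb2 : vb \in Lfun Pn 2%:E.
  by apply: Lfun2D; [case: regb => -[]|exact: correction_Lfun2 regb].
have u2 : u \in Lfun Pd 2%:E.
  rewrite -uE; apply: Lfun2D; first by case: regb => -[].
  by apply: Lfun2N; exact: ratio_correction_Lfun2 regb.
have uw2 : u \- w \* dl \in Lfun Pd 2%:E.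
  rewrite -uwE; apply: Lfun2D; first by case: reg => -[].
  by apply: Lfun2N; exact: ratio_correction_Lfun2 reg.
have dl2 : dl \in Lfun Pn 2%:E.
  apply: Lfun2D; last exact: Lfun2N.
  by apply: Lfun2D; [case: reg => -[]|exact: correction_Lfun2 reg].
(* Square integrability of [dl] under [Pn] does not give this; it is read off as a difference of the
   two integrands under [Pd]. *)
have wdl2 : w \* dl \in Lfun Pd 2%:E.
  rewrite (_ : w \* dl = u \+ (\- (u \- w \* dl))).
    by apply: Lfun2D => //; exact: Lfun2N.
  by apply/funext => x /=; ring.
pose sd k x := dl x * score r x theta k 0.
(* Subtracting the two residuals cancels the common term [derive1 f], and both have zero expectation
   against the score. *)
have sdE k : sd k =
    (fun x => (derive1 f (r x theta) - vb x) * score r x theta k 0) \-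
    (fun x => (derive1 f (r x theta) - v x) * score r x theta k 0).
  by apply/funext => x; rewrite /sd /dl /=; ring.
have sd1 k : sd k \in Lfun Pn 1.
  by rewrite sdE rpredB//; [exact: residual_score_Lfun1 regb k
                          |exact: residual_score_Lfun1 reg k].
have sd0 k : ('E_Pn[sd k] = 0)%E.
  rewrite sdE expectationB; [|exact: residual_score_Lfun1 regb k
                             |exact: residual_score_Lfun1 reg k].
  by rewrite (residual_score_expectation regb) (residual_score_expectation reg) subee.
have span1 (g : X -> R) : lin_span (fun x => score r x theta) g ->
    g \* dl \in Lfun Pn 1 /\ ('E_Pn[(g \* dl)%R] = 0)%E.
  move=> [b gE].
  have -> : g \* dl = fun x => \sum_k b k 0 * sd k x.
    apply/funext => x /=; rewrite gE mulr_suml.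
    by apply: eq_bigr => k _; rewrite /sd -mulrA (mulrC (dl x)).
  split; first exact: (@Lfun_lincomb _ _ _ _ _ 1).
  by rewrite expectation_lincomb// big1// => k _; rewrite sd0 mule0.
have dl0 : ('E_Pn[dl] = 0)%E.
  have [_] := span1 _ (one_in_span _ th).
  by congr (_ = _); congr expectation; apply/funext => x /=; rewrite mul1r.
have [g1 g0] := span1 _ (bar_condition _ th _ _ ratio regb).
apply: (variance_sum_le rho_gt0 dPn) => //.
set g := fun x => _ in g1 g0.
have vbdl1 : vb \* dl \in Lfun Pn 1 by exact: Lfun2_mul_Lfun1.
(* Here [g] equals [u] minus [vb / rho], so its orthogonality to [dl] is exactly the required
   relation between the cross terms. *)
have -> : u \* dl = (rho^-1 \o* (vb \* dl)) \+ (g \* dl).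
  by apply/funext => x; rewrite /= /g /u /vb -/corrb; ring.
rewrite expectationD//; last by rewrite Lfun_scale.
by rewrite g0 adde0 expectationZl// muleA -EFinM mulfV ?gt_eqF// mul1e.
Qed.
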